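(* Let $\langle\mathbf A,\sim,\exists,\forall\rangle$ be a finite subdirectly irreducible $MG_\sim$-algebra such that $\langle\mathbf A,\sim\rangle=\prod_{i=1}^r\langle\mathbf C_{n_i},\sim\rangle$. (1) If $\langle\mathbf A,\sim,\exists,\forall\rangle$ has a fixed point $d$ (i.e. $d=\sim d$), then $\langle\mathbf A,\sim,\exists,\forall\rangle\in\mathbb{CMG}_\sim$ if and only if $d\in\exists A$. (2) If $\langle\mathbf A,\sim,\exists,\forall\rangle$ has no fixed points, then $\langle\mathbf A,\sim,\exists,\forall\rangle\in\mathbb{CMG}_\sim$ if and only if there exists $t\in\exists A$ such that $(\sim t)(i)$ covers $t(i)$ for all $i=1,\dots,r$.
   Context: A Gödel algebra is a Heyting algebra $\langle A,\vee,\wedge,\to,0,1\rangle$ satisfying $(x\to y)\vee(y\to x)\approx 1$; put $\neg x:=x\to 0$. A De Morgan algebra is a bounded distributive lattice with a unary operation $\sim$ satisfying $\sim\sim x\approx x$ and $\sim(x\wedge y)\approx \sim x\vee\sim y$. A $G_\sim$-algebra $\langle \mathbf A,\sim\rangle$ is a Gödel algebra $\mathbf A$ with a unary operation $\sim$ that makes its bounded lattice reduct a De Morgan algebra and satisfies $\neg x\le\sim x$. For a natural number $n$, $\langle\mathbf C_n,\sim\rangle$ denotes the totally ordered $G_\sim$-algebra with $n$ elements. An $MG_\sim$-algebra is an algebra $\langle A,\vee,\wedge,\to,\sim,\exists,\forall,0,1\rangle$ such that $\langle \mathbf A,\sim\rangle$ is a $G_\sim$-algebra and: (M1) $\forall x\to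 x\approx 1$; (M2) $\forall(x\to\forall y)\approx\exists x\to\forall y$; (M3) $\forall(\forall x\to y)\approx\forall x\to\forall y$; (M4) $\forall(\exists x\vee y)\approx\exists x\vee\forall y$; (Q) $\forall x\approx\ \sim\exists\sim x$. $\exists A=\{\exists a:a\in A\}$. $\mathbb{CMG}_\sim$ is the variety of $MG_\sim$-algebras satisfying (C): $\exists(x\wedge\sim x)\le\forall(x\vee\sim x)$. For $x\in\prod_i C_{n_i}$, $x(i)$ is its $i$-th coordinate; in a chain, $q$ covers $p$ if $p<q$ and no element lies strictly between them.
   Formalization: The chains are required to have at least two elements (each n_i ≥ 2); with a one-element factor part (2) fails, e.g. for C_1 × C_2 with identity quantifiers, since nothing covers anything in C_1. *)

(* Defs.v *)
From HB Require Import structures.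
From mathcomp Require Import all_boot all_order.

Set Implicit Arguments.
Unset Strict Implicit.
Unset Printing Implicit Defensive.

Import Order.TTheory.
Local Open Scope order_scope.

(* Heyting algebras, with the residuation law as axiom; distributivity is a
   consequence of it, so building on distributive lattices loses nothing. *)
HB.mixin Record isHeyting d T of Order.TBDistrLattice d T := {
  imp : T -> T -> T;
  lexI_imp : forall x y z : T, (x `&` y <= z) = (x <= imp y z)
}.

#[short(type="heytingType")]
HB.structure Definition Heyting d :=
  { T of isHeyting d T & Order.TBDistrLattice d T }.

Definition neg d (T : heytingType d) (x : T) : T := imp x \bot.

HB.mixin Record Heyting_isGodel d T of Heyting d T := {
  imp_prelinear : forall x y : T, imp x y `|` imp y x = \top
}.

#[short(type="godelType")]
HB.structure Definition Godel d := { T of Heyting_isGodel d T & Heyting d T }.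

HB.mixin Record isDeMorgan d T of Order.TBDistrLattice d T := {
  sim : T -> T;
  simK : forall x : T, sim (sim x) = x;
  simI : forall x y : T, sim (x `&` y) = sim x `|` sim y
}.

#[short(type="deMorganType")]
HB.structure Definition DeMorgan d :=
  { T of isDeMorgan d T & Order.TBDistrLattice d T }.

HB.mixin Record isGsim d T of Godel d T & DeMorgan d T := {
  neg_le_sim : forall x : T, neg x <= sim x
}.

#[short(type="gsimType")]
HB.structure Definition Gsim d :=
  { T of isGsim d T & Godel d T & DeMorgan d T }.

HB.mixin Record isMonadic d T of Gsim d T := {
  mexists : T -> T;
  mforall : T -> T;
  mforall_le : forall x : T, imp (mforall x) x = \top;
  mforall_impr : forall x y : T,
    mforall (imp x (mforall y)) = imp (mexists x) (mforall y);
  mforall_impl : forall x y : T,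
    mforall (imp (mforall x) y) = imp (mforall x) (mforall y);
  mforallU : forall x y : T,
    mforall (mexists x `|` y) = mexists x `|` mforall y;
  mforall_sim : forall x : T, mforall x = sim (mexists (sim x))
}.

#[short(type="mgsimType")]
HB.structure Definition MGsim d := { T of isMonadic d T & Gsim d T }.

#[short(type="finMGsimType")]
HB.structure Definition FinMGsim d := { T of MGsim d T & Finite T }.

Definition in_mexists d (A : mgsimType d) (x : A) : Prop :=
  exists a : A, x = mexists a.

Definition CMG d (A : mgsimType d) : Prop :=
  forall x : A, mexists (x `&` sim x) <= mforall (x `|` sim x).

Record gsim_morphism d1 d2 (A : gsimType d1) (B : gsimType d2) (f : A -> B) :
  Prop := GsimMorphism {
  gsim_morphU : {morph f : x y / x `|` y};
  gsim_morphI : {morph f : x y / x `&` y};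
  gsim_morph_imp : {morph f : x y / imp x y};
  gsim_morph_sim : {morph f : x / sim x};
  gsim_morph0 : f \bot = \bot;
  gsim_morph1 : f \top = \top
}.

Record mgsim_morphism d1 d2 (A : mgsimType d1) (B : mgsimType d2) (f : A -> B) :
  Prop := MGsimMorphism {
  mgsim_gsim_morphism : gsim_morphism f;
  mgsim_morph_mexists : {morph f : x / mexists x};
  mgsim_morph_mforall : {morph f : x / mforall x}
}.

Definition gsim_isomorphism d1 d2 (A : gsimType d1) (B : gsimType d2)
  (f : A -> B) : Prop := gsim_morphism f /\ bijective f.

(* A map into a product of algebras B i is given by its components f i; it is
   a subdirect embedding when it is an injective homomorphism all of whose
   components are onto. *)
Definition subdirect_embedding d (A : mgsimType d) (I : Type)
    (dB : I -> Order.disp_t) (B : forall i, mgsimType (dB i))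
    (f : forall i, A -> B i) : Prop :=
  [/\ forall i, mgsim_morphism (f i),
      forall x y, (forall i, f i x = f i y) -> x = y
    & forall i (b : B i), exists a, f i a = b].

(* Since I may be empty, the one-element algebra is not subdirectly
   irreducible. *)
Definition subdirectly_irreducible d (A : mgsimType d) : Prop :=
  forall (I : Type) (dB : I -> Order.disp_t) (B : forall i, mgsimType (dB i))
    (f : forall i, A -> B i),
  subdirect_embedding f -> exists i, bijective (f i).

Definition covers d (T : porderType d) (q p : T) : Prop :=
  p < q /\ forall z : T, ~ (p < z /\ z < q).

(* The chain C_n is {0 < 1 < ... < n-1}; 'I_n carries bounds only when n is
   syntactically a successor, hence n.-1.+1, which is n for n > 0. *)
Definition chain (n : nat) : Type := 'I_n.-1.+1.

HB.instance Definition _ n := Order.Total.copy (chain n) 'I_n.-1.+1.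
HB.instance Definition _ n := Finite.copy (chain n) 'I_n.-1.+1.
Definition chain_bot n : chain n := ord0.
Definition chain_top n : chain n := ord_max.
HB.instance Definition _ n :=
  @Order.hasBottom.Build _ (chain n) (chain_bot n) (fun=> leq0n _).
HB.instance Definition _ n :=
  @Order.hasTop.Build _ (chain n) (chain_top n) (fun i => leq_ord i).

Lemma card_chain n : (0 < n)%N -> #|{: chain n}| = n.
Proof. by move=> n_gt0; rewrite card_ord prednK. Qed.

Section Chain.
Variable n : nat.
Implicit Types x y z : chain n.

Definition chain_imp x y : chain n := if x <= y then \top else y.
Definition chain_sim x : chain n := rev_ord (x : 'I_n.-1.+1).

Lemma chain_lexI_imp x y z : (x `&` y <= z) = (x <= chain_imp y z).
Proof.
rewrite /chain_imp leIx; case: (leP y z) => _; last by rewrite orbF.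
by rewrite orbT lex1.
Qed.

HB.instance Definition _ :=
  @isHeyting.Build Order.OrdinalOrder.ord_display (chain n) chain_imp
    chain_lexI_imp.

Lemma chain_prelinear x y : imp x y `|` imp y x = \top.
Proof.
rewrite /imp /= /chain_imp; case: (leP x y) => [|/ltW ->]; first by rewrite join1x.
by rewrite joinx1.
Qed.

HB.instance Definition _ :=
  @Heyting_isGodel.Build Order.OrdinalOrder.ord_display (chain n)
    chain_prelinear.

Lemma chain_simK x : chain_sim (chain_sim x) = x.
Proof. exact: rev_ordK. Qed.

Lemma chain_le_sim x y : (chain_sim x <= chain_sim y) = (y <= x).
Proof. by rewrite !leEord /= leq_sub2lE // ltn_ord. Qed.

Lemma chain_simI x y : chain_sim (x `&` y) = chain_sim x `|` chain_sim y.
Proof.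
case: (leP x y) => [le_xy|/ltW le_yx].
  by rewrite join_l // chain_le_sim.
by rewrite join_r // chain_le_sim.
Qed.

HB.instance Definition _ :=
  @isDeMorgan.Build Order.OrdinalOrder.ord_display (chain n) chain_sim
    chain_simK chain_simI.

Lemma chain_neg_le_sim x : neg x <= sim x.
Proof.
rewrite /neg /imp /= /chain_imp lex0; case: eqP => [->|_]; last exact: le0x.
by rewrite -chain_le_sim chain_simK le0x.
Qed.

HB.instance Definition _ :=
  @isGsim.Build Order.OrdinalOrder.ord_display (chain n) chain_neg_le_sim.

End Chain.

Definition gsim_prod (I : finType) d (C : I -> gsimType d) : Type :=
  {dffun forall i, C i}.

Section Product.
Variables (I : finType) (d : Order.disp_t) (C : I -> gsimType d).
Local Notation P := (gsim_prod C).
Implicit Types x y z : P.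

HB.instance Definition _ := Choice.copy P {dffun forall i, C i}.

Definition prod_coord x (i : I) : C i := (x : {dffun forall i, C i}) i.

Definition prod_of (f : forall i, C i) : P := [ffun i => f i].

Lemma prod_ofE f i : prod_coord (prod_of f) i = f i.
Proof. exact: ffunE. Qed.

Lemma gsim_prodP x y : (forall i, prod_coord x i = prod_coord y i) -> x = y.
Proof. by move=> xy; apply/ffunP. Qed.

Definition prod_le x y := [forall i, prod_coord x i <= prod_coord y i].
Definition prod_lt x y := (y != x) && prod_le x y.
Definition prod_meet x y := prod_of (fun i => prod_coord x i `&` prod_coord y i).
Definition prod_join x y := prod_of (fun i => prod_coord x i `|` prod_coord y i).
Definition prod_bot : P := prod_of (fun=> \bot).
Definition prod_top : P := prod_of (fun=> \top).
Definition prod_imp x y := prod_of (fun i => imp (prod_coord x i) (prod_coord y i)).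
Definition prod_sim x := prod_of (fun i => sim (prod_coord x i)).

Fact prod_le_def x y : prod_le x y = (prod_meet x y == x).
Proof.
apply/forallP/eqP => [le_xy|eq_x i].
  by apply: gsim_prodP => i; rewrite prod_ofE; exact/meet_l/le_xy.
by rewrite -eq_x prod_ofE leIr.
Qed.

Fact prod_lt_def x y : prod_lt x y = (y != x) && prod_le x y.
Proof. by []. Qed.

Fact prod_meetC : commutative prod_meet.
Proof. by move=> x y; apply: gsim_prodP => i; rewrite !prod_ofE meetC. Qed.

Fact prod_joinC : commutative prod_join.
Proof. by move=> x y; apply: gsim_prodP => i; rewrite !prod_ofE joinC. Qed.

Fact prod_meetA : associative prod_meet.
Proof. by move=> x y z; apply: gsim_prodP => i; rewrite !prod_ofE meetA. Qed.

Fact prod_joinA : associative prod_join.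
Proof. by move=> x y z; apply: gsim_prodP => i; rewrite !prod_ofE joinA. Qed.

Fact prod_joinKI y x : prod_meet x (prod_join x y) = x.
Proof. by apply: gsim_prodP => i; rewrite !prod_ofE joinKI. Qed.

Fact prod_meetKU y x : prod_join x (prod_meet x y) = x.
Proof. by apply: gsim_prodP => i; rewrite !prod_ofE meetKU. Qed.

Fact prod_meetUl : left_distributive prod_meet prod_join.
Proof. by move=> x y z; apply: gsim_prodP => i; rewrite !prod_ofE meetUl. Qed.

Fact prod_meetxx : idempotent_op prod_meet.
Proof. by move=> x; apply: gsim_prodP => i; rewrite !prod_ofE meetxx. Qed.

HB.instance Definition _ :=
  @Order.isMeetJoinDistrLattice.Build d P prod_le prod_lt prod_meet prod_join
    prod_le_def prod_lt_def prod_meetC prod_joinC prod_meetA prod_joinA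
    prod_joinKI prod_meetKU prod_meetUl prod_meetxx.

Lemma gsim_prod_leP x y :
  reflect (forall i, prod_coord x i <= prod_coord y i) (x <= y).
Proof. exact: forallP. Qed.

Fact prod_le0x x : prod_bot <= x.
Proof. by apply/gsim_prod_leP => i; rewrite prod_ofE le0x. Qed.

Fact prod_lex1 x : x <= prod_top.
Proof. by apply/gsim_prod_leP => i; rewrite prod_ofE lex1. Qed.

HB.instance Definition _ := @Order.hasBottom.Build d P prod_bot prod_le0x.
HB.instance Definition _ := @Order.hasTop.Build d P prod_top prod_lex1.

Fact prod_lexI_imp x y z : (x `&` y <= z) = (x <= prod_imp y z).
Proof.
apply/gsim_prod_leP/gsim_prod_leP => le_xyz i; move: (le_xyz i).
  by rewrite !prod_ofE lexI_imp.
by rewrite !prod_ofE -lexI_imp.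
Qed.

HB.instance Definition _ := @isHeyting.Build d P prod_imp prod_lexI_imp.

Fact prod_prelinear x y : imp x y `|` imp y x = \top.
Proof. by apply: gsim_prodP => i; rewrite !prod_ofE imp_prelinear. Qed.

HB.instance Definition _ := @Heyting_isGodel.Build d P prod_prelinear.

Fact prod_simK x : prod_sim (prod_sim x) = x.
Proof. by apply: gsim_prodP => i; rewrite !prod_ofE simK. Qed.

Fact prod_simI x y : prod_sim (x `&` y) = prod_sim x `|` prod_sim y.
Proof. by apply: gsim_prodP => i; rewrite !prod_ofE simI. Qed.

HB.instance Definition _ := @isDeMorgan.Build d P prod_sim prod_simK prod_simI.

Fact prod_neg_le_sim x : neg x <= sim x.
Proof. by apply/gsim_prod_leP => i; rewrite !prod_ofE neg_le_sim. Qed.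

HB.instance Definition _ := @isGsim.Build d P prod_neg_le_sim.

End Product.

(* Main.v *)
Require Import Defs.
From HB Require Import structures.
From mathcomp Require Import all_boot all_order.
From mathcomp Require Import zify.

Set Implicit Arguments.
Unset Strict Implicit.
Unset Printing Implicit Defensive.

Import Order.TTheory.
Local Open Scope order_scope.

(** The elements [x `&` sim x] have a greatest member [c], whose coordinates are
    the (lower) midpoints of the chains, and [CMG A] says exactly that [c] is
    fixed by [mexists].  If [c] is not a fixed point of [sim], one must still
    exclude that some chains have odd and others even length.  In that case
    [b := neg (sim (imp (sim c) c))] is the indicator of the odd chains: a
    complemented element of the range of [mexists] other than [\bot] and
    [\top].  Then [A] is the product of the algebras on [0, b] and [0, sim b],
    against subdirect irreducibility. *)

(** * De Morgan negation and Heyting implication *)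

Section DeMorganTheory.
Context {d : Order.disp_t} {A : deMorganType d}.
Implicit Types x y : A.

Lemma simU x y : sim (x `|` y) = sim x `&` sim y.
Proof. by rewrite -[RHS]simK simI !simK. Qed.

Lemma le_sim x y : (sim x <= sim y) = (y <= x).
Proof. by rewrite leEmeet -simU (inj_eq (can_inj simK)) joinC -leEjoin. Qed.

Lemma sim0 : sim \bot = \top :> A.
Proof. by apply/eqP; rewrite -le1x -le_sim simK le0x. Qed.

Lemma sim1 : sim \top = \bot :> A.
Proof. by rewrite -sim0 simK. Qed.

End DeMorganTheory.

Section HeytingTheory.
Context {d : Order.disp_t} {A : heytingType d}.
Implicit Types x y z b : A.

Lemma impI_le x y : imp x y `&` x <= y.
Proof. by rewrite lexI_imp. Qed.

Lemma imp_eq1 x y : (imp x y == \top) = (x <= y).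
Proof. by rewrite -le1x -lexI_imp meet1x. Qed.

(** Implication in the interval [0, b] is [imp] met with [b]; this identity makes the map [x] to
    [x & b] preserve it. *)
Lemma imp_relative b x y : b `&` imp (x `&` b) (y `&` b) = b `&` imp x y.
Proof.
apply/le_anti/andP; split; rewrite lexI leIl -lexI_imp /=.
  rewrite [b `&` _]meetC -meetA [b `&` x]meetC.
  exact: le_trans (impI_le _ _) (leIl _ _).
rewrite lexI; apply/andP; split; last by rewrite -meetA leIl.
by apply: le_trans (impI_le x y); rewrite leI2 ?leIl ?leIr.
Qed.

End HeytingTheory.

(** * The quantifiers and the subalgebra that is their common range *)

Section MonadicTheory.
Context {d : Order.disp_t} {A : mgsimType d}.
Implicit Types x y b : A.

Lemma mforall_lex x : mforall x <= x.
Proof. by rewrite -imp_eq1 mforall_le. Qed.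

(** (M3) with both arguments [\top]: the inner implication is [\top], and the right side has the
    form [imp z z]. *)
Lemma mforall1 : mforall \top = \top :> A.
Proof.
have /eqP imp1 : imp (mforall \top) (mforall \top) == \top :> A by rewrite imp_eq1.
by rewrite -mforall_impl (eqP (_ : imp _ _ == \top)) ?imp_eq1 ?lex1 in imp1.
Qed.

(** By (M3) the implication between the two values is [mforall] of [imp (mforall x) y], and
    [mforall x <= x <= y] makes the argument [\top]. *)
Lemma mforall_homo : {homo @mforall _ A : x y / x <= y}.
Proof.
move=> x y le_xy; rewrite -imp_eq1 -mforall_impl.
have /eqP -> : imp (mforall x) y == \top.
  by rewrite imp_eq1 (le_trans (mforall_lex x)).
by rewrite mforall1.
Qed.

Lemma mexistsE x : mexists x = sim (mforall (sim x)).
Proof. by rewrite mforall_sim !simK. Qed.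

Lemma sim_mexists x : sim (mexists x) = mforall (sim x).
Proof. by rewrite mexistsE simK. Qed.

Lemma mexists_gex x : x <= mexists x.
Proof. by rewrite mexistsE -le_sim simK mforall_lex. Qed.

Lemma mexists_homo : {homo @mexists _ A : x y / x <= y}.
Proof. by move=> x y le_xy; rewrite !mexistsE le_sim mforall_homo ?le_sim. Qed.

Lemma mexists_mforall x : mexists (mforall x) = mforall x.
Proof.
apply/le_anti; rewrite mexists_gex andbT -imp_eq1 -mforall_impr.
have /eqP -> : imp (mforall x) (mforall x) == \top by rewrite imp_eq1.
by rewrite mforall1.
Qed.

Lemma mforall_mexists x : mforall (mexists x) = mexists x.
Proof. by rewrite mexistsE mforall_sim simK mexists_mforall. Qed.

Lemma mexists_id x : mexists (mexists x) = mexists x.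
Proof. by rewrite -[mexists x]mforall_mexists mexists_mforall. Qed.

(** This rests on idempotence. Membership in the range is used below as this equation, and the
    [mexists_fix_*] lemmas with [mexists0] show that the range is a subalgebra. *)
Lemma in_mexistsP x : in_mexists x <-> mexists x = x.
Proof. by split=> [[a ->]|<-]; [rewrite mexists_id | exists x]. Qed.

Lemma mexists_fix_mforall x : mexists x = x -> mforall x = x.
Proof. by move=> <-; rewrite mforall_mexists. Qed.

Lemma mexists_fix_sim x : mexists x = x -> mexists (sim x) = sim x.
Proof. by move=> <-; rewrite sim_mexists mexists_mforall. Qed.

Lemma mexists_fix_imp x y :
  mexists x = x -> mexists y = y -> mexists (imp x y) = imp x y.
Proof.
move=> /mexists_fix_mforall <- /mexists_fix_mforall <-.
by rewrite -mforall_impl mexists_mforall.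
Qed.

Lemma mexists_fix_meet x y :
  mexists x = x -> mexists y = y -> mexists (x `&` y) = x `&` y.
Proof.
move=> ex ey; apply/le_anti; rewrite mexists_gex andbT lexI.
by rewrite -{2}ex -{3}ey !mexists_homo ?leIl ?leIr.
Qed.

Lemma mexists_fix_join x y :
  mexists x = x -> mexists y = y -> mexists (x `|` y) = x `|` y.
Proof.
move=> /mexists_fix_sim ex /mexists_fix_sim ey.
by rewrite -[x `|` y]simK simU mexists_fix_sim // mexists_fix_meet.
Qed.

Lemma mexists0 : mexists \bot = \bot :> A.
Proof. by rewrite mexistsE sim0 mforall1 sim1. Qed.

Lemma mforallI x y : mforall (x `&` y) = mforall x `&` mforall y.
Proof.
apply/le_anti/andP; split; first by rewrite lexI !mforall_homo ?leIl ?leIr.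
rewrite -(mexists_fix_mforall (mexists_fix_meet (mexists_mforall x)
  (mexists_mforall y))).
by rewrite mforall_homo // leI2 ?mforall_lex.
Qed.

(** * Central elements and the direct factors that they cut out *)

Record central b : Prop := Central {
  central_mexists : mexists b = b;
  central_meet_sim : b `&` sim b = \bot
}.

Lemma central_sim b : central b -> central (sim b).
Proof.
move=> [eb bb]; split; first exact: mexists_fix_sim.
by rewrite simK meetC.
Qed.

(** The other half of complementation is the De Morgan dual of [central_meet_sim]. *)
Lemma central_join_sim b : central b -> b `|` sim b = \top.
Proof. by move=> [_ bb]; rewrite -[b in b `|` _]simK -simI meetC bb sim0. Qed.

Lemma mexists_meet_central b x :
  central b -> mexists (x `&` b) = mexists x `&` b.
Proof.
move=> cb; have eb := central_mexists cb; apply/le_anti/andP; split.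
  by rewrite lexI -{3}eb !mexists_homo ?leIl ?leIr.
(* The bound belongs to the range of [mexists], so it also bounds [mexists x]; meeting with [b] then
   removes [sim b]. *)
have le_x : x <= mexists (x `&` b) `|` sim b.
  rewrite -[x in x <= _]meetx1 -(central_join_sim cb) meetUr.
  by rewrite leU2 ?mexists_gex ?leIr.
have := mexists_homo le_x.
rewrite mexists_fix_join ?mexists_id ?(mexists_fix_sim eb) // => {}le_x.
apply: le_trans (leI2 le_x (lexx b)) _.
by rewrite meetUl [sim b `&` _]meetC (central_meet_sim cb) joinx0 leIl.
Qed.

Lemma mforall_meet_central b x :
  central b -> mforall (x `&` b) = mforall x `&` b.
Proof.
by move=> /central_mexists/mexists_fix_mforall eb; rewrite mforallI eb.
Qed.

(** Negation in [0, b] is [sim] met with [b]. This identity makes it involutive and compatible with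
    the projection from [A]. *)
Lemma central_meet_simI b x : central b -> b `&` sim (b `&` x) = b `&` sim x.
Proof. by case=> _ bb; rewrite simI meetUr bb join0x. Qed.

End MonadicTheory.

(** The type carries the proof [cb], so that canonical instances whose laws rest on centrality can
    recover it from the type alone. *)
Definition interval d (A : mgsimType d) (b : A) (cb : central b) : Type :=
  {x : A | x <= b}.

Section Interval.
Context {d : Order.disp_t} {A : mgsimType d} {b : A} (cb : central b).
Local Notation B := (interval cb).
Implicit Types x y z : B.

HB.instance Definition _ := [isSub of B for (fun x : B => sval x)].
HB.instance Definition _ := [Choice of B by <:].

(** Both the projection from [A] and the constructor for the operations: each is computed in [A] and
    cut down by [b]. The cut is absorbed for lattice operations and quantifiers, and remains for
    [imp] and [sim]. *)
Definition to_interval (a : A) : B :=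
  exist (fun x : A => x <= b) (a `&` b) (leIr b a).

Lemma interval_le_top x : val x <= b.
Proof. by case: x. Qed.

Lemma val_to_interval_id (a : A) : a <= b -> val (to_interval a) = a.
Proof. exact: meet_l. Qed.

Definition interval_le x y := val x <= val y.
Definition interval_lt x y := (y != x) && interval_le x y.
Definition interval_meet x y := to_interval (val x `&` val y).
Definition interval_join x y := to_interval (val x `|` val y).
Definition interval_imp x y := to_interval (imp (val x) (val y)).
Definition interval_sim x := to_interval (sim (val x)).
Definition interval_mexists x := to_interval (mexists (val x)).
Definition interval_mforall x := to_interval (mforall (val x)).

Lemma val_interval_meet x y : val (interval_meet x y) = val x `&` val y.
Proof. by rewrite val_to_interval_id // leIxl ?interval_le_top. Qed.

Lemma val_interval_join x y : val (interval_join x y) = val x `|` val y.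
Proof. by rewrite val_to_interval_id // leUx !interval_le_top. Qed.

Lemma val_interval_imp x y : val (interval_imp x y) = b `&` imp (val x) (val y).
Proof. exact: meetC. Qed.

Lemma val_interval_sim x : val (interval_sim x) = b `&` sim (val x).
Proof. exact: meetC. Qed.

Lemma val_interval_mexists x : val (interval_mexists x) = mexists (val x).
Proof.
rewrite val_to_interval_id // -[leRHS](central_mexists cb).
exact/mexists_homo/interval_le_top.
Qed.

Lemma val_interval_mforall x : val (interval_mforall x) = mforall (val x).
Proof.
by rewrite val_to_interval_id // (le_trans (mforall_lex _)) ?interval_le_top.
Qed.

Fact interval_le_def x y : interval_le x y = (interval_meet x y == x).
Proof. by rewrite -val_eqE val_interval_meet /interval_le leEmeet. Qed.

Fact interval_lt_def x y : interval_lt x y = (y != x) && interval_le x y.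
Proof. by []. Qed.

Fact interval_meetC : commutative interval_meet.
Proof. by move=> x y; apply: val_inj; rewrite !val_interval_meet meetC. Qed.

Fact interval_joinC : commutative interval_join.
Proof. by move=> x y; apply: val_inj; rewrite !val_interval_join joinC. Qed.

Fact interval_meetA : associative interval_meet.
Proof. by move=> x y z; apply: val_inj; rewrite !val_interval_meet meetA. Qed.

Fact interval_joinA : associative interval_join.
Proof. by move=> x y z; apply: val_inj; rewrite !val_interval_join joinA. Qed.

Fact interval_joinKI y x : interval_meet x (interval_join x y) = x.
Proof.
by apply: val_inj; rewrite val_interval_meet val_interval_join joinKI.
Qed.

Fact interval_meetKU y x : interval_join x (interval_meet x y) = x.
Proof.
by apply: val_inj; rewrite val_interval_join val_interval_meet meetKU.
Qed.

Fact interval_meetUl : left_distributive interval_meet interval_join.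
Proof.
move=> x y z; apply: val_inj.
by rewrite !(val_interval_meet, val_interval_join) meetUl.
Qed.

Fact interval_meetxx : idempotent_op interval_meet.
Proof. by move=> x; apply: val_inj; rewrite val_interval_meet meetxx. Qed.

HB.instance Definition _ :=
  @Order.isMeetJoinDistrLattice.Build d B interval_le interval_lt interval_meet
    interval_join interval_le_def interval_lt_def interval_meetC interval_joinC
    interval_meetA interval_joinA interval_joinKI interval_meetKU
    interval_meetUl interval_meetxx.

Lemma le_interval x y : (x <= y) = (val x <= val y).
Proof. by []. Qed.

Fact interval_le0x x : to_interval \bot <= x.
Proof. by rewrite le_interval val_to_interval_id le0x. Qed.

Fact interval_lex1 x : x <= to_interval \top.
Proof. by rewrite le_interval /= meet1x interval_le_top. Qed.

HB.instance Definition _ := @Order.hasBottom.Build d B _ interval_le0x.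
HB.instance Definition _ := @Order.hasTop.Build d B _ interval_lex1.

Fact interval_lexI_imp x y z : (x `&` y <= z) = (x <= interval_imp y z).
Proof.
rewrite !le_interval val_interval_meet val_interval_imp lexI interval_le_top.
exact: lexI_imp.
Qed.

HB.instance Definition _ := @isHeyting.Build d B _ interval_lexI_imp.

Fact interval_prelinear x y : imp x y `|` imp y x = \top.
Proof.
apply: val_inj; rewrite val_interval_join !val_interval_imp -meetUr.
by rewrite imp_prelinear meetC.
Qed.

HB.instance Definition _ := @Heyting_isGodel.Build d B interval_prelinear.

Fact interval_simK x : interval_sim (interval_sim x) = x.
Proof.
apply: val_inj; rewrite !val_interval_sim central_meet_simI // simK.
by rewrite meet_r ?interval_le_top.
Qed.

Fact interval_simI x y :
  interval_sim (x `&` y) = interval_sim x `|` interval_sim y.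
Proof.
apply: val_inj; rewrite val_interval_join !val_interval_sim val_interval_meet.
by rewrite simI meetUr.
Qed.

HB.instance Definition _ := @isDeMorgan.Build d B _ interval_simK interval_simI.

Fact interval_neg_le_sim x : neg x <= sim x.
Proof.
rewrite le_interval val_interval_imp val_interval_sim val_to_interval_id ?le0x//.
by rewrite leI2 ?neg_le_sim.
Qed.

HB.instance Definition _ := @isGsim.Build d B interval_neg_le_sim.

Fact interval_mforall_le x : imp (interval_mforall x) x = \top.
Proof. by apply/eqP; rewrite imp_eq1 le_interval val_interval_mforall mforall_lex. Qed.

Fact interval_mforall_impr x y :
  interval_mforall (imp x (interval_mforall y)) =
  imp (interval_mexists x) (interval_mforall y).
Proof.
apply: val_inj; rewrite val_interval_mforall !val_interval_imp.
rewrite !val_interval_mforall val_interval_mexists.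
by rewrite meetC mforall_meet_central // mforall_impr meetC.
Qed.

Fact interval_mforall_impl x y :
  interval_mforall (imp (interval_mforall x) y) =
  imp (interval_mforall x) (interval_mforall y).
Proof.
apply: val_inj; rewrite val_interval_mforall !val_interval_imp.
rewrite !val_interval_mforall.
by rewrite meetC mforall_meet_central // mforall_impl meetC.
Qed.

Fact interval_mforallU x y :
  interval_mforall (interval_mexists x `|` y) =
  interval_mexists x `|` interval_mforall y.
Proof.
apply: val_inj; rewrite val_interval_mforall !val_interval_join.
by rewrite val_interval_mforall val_interval_mexists mforallU.
Qed.

(** Centrality enters twice: [mexists] commutes with the meet by [b], and [sim] then ignores that
    meet below [b]. *)
Fact interval_mforall_sim x :
  interval_mforall x = sim (interval_mexists (sim x)).
Proof.
apply: val_inj; rewrite val_interval_mforall val_interval_sim.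
rewrite val_interval_mexists val_interval_sim [b `&` sim (val x)]meetC.
rewrite mexists_meet_central // [_ `&` b]meetC central_meet_simI //.
by rewrite -mforall_sim meet_r // (le_trans (mforall_lex _)) ?interval_le_top.
Qed.

HB.instance Definition _ :=
  @isMonadic.Build d B _ _ interval_mforall_le interval_mforall_impr
    interval_mforall_impl interval_mforallU interval_mforall_sim.

Lemma to_interval_morphism : mgsim_morphism to_interval.
Proof.
split; first split.
- by move=> x y; apply: val_inj; rewrite val_interval_join /= meetUl.
- by move=> x y; apply: val_inj; rewrite val_interval_meet /= meetACA meetxx.
- move=> x y; apply: val_inj; rewrite val_interval_imp imp_relative.
  exact: meetC.
- move=> x; apply: val_inj; rewrite val_interval_sim /= [x `&` b]meetC.
  by rewrite central_meet_simI // meetC.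
- by [].
- by [].
- move=> x; apply: val_inj; rewrite val_interval_mexists /=.
  by rewrite mexists_meet_central.
- move=> x; apply: val_inj; rewrite val_interval_mforall /=.
  by rewrite mforall_meet_central.
Qed.

Lemma to_interval_surj x : exists a, to_interval a = x.
Proof.
by exists (val x); apply/val_inj/val_to_interval_id/interval_le_top.
Qed.

(** Both [b] and [\top] are projected to [b]. *)
Lemma to_interval_inj_eq1 : injective to_interval -> b = \top.
Proof. by apply; apply: val_inj; rewrite /= meetxx meet1x. Qed.

End Interval.

(** The projections to [0, b] and [0, sim b] form a subdirect embedding, so one is bijective;
    injectivity forces the top of that interval to be [\top]. *)
Lemma subdirectly_irreducible_central d (A : mgsimType d) (b : A) :
  subdirectly_irreducible A -> central b -> b = \bot \/ b = \top.
Proof.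
move=> A_si cb; pose c (i : bool) := if i then b else sim b.
have cc i : central (c i) by case: i => //; apply: central_sim.
have [|i /bij_inj/to_interval_inj_eq1] :=
    A_si bool (fun=> d) (fun i => interval (cc i)) (fun i => to_interval (cc i)).
  split=> [i|x y eq_xy|i]; [exact: to_interval_morphism| |exact: to_interval_surj].
  (* Each element is the join of its parts below [b] and below [sim b]. *)
  rewrite -[x]meetx1 -[y]meetx1 -(central_join_sim cb) !meetUr.
  have /(congr1 val)/= -> := eq_xy true.
  by have /(congr1 val)/= -> := eq_xy false.
case: i => /= eq1; [by right | left].
by rewrite -[b]simK eq1 sim1.
Qed.

(** * Coordinates of [A] in the product of chains *)

Section ChainProduct.
Context {d : Order.disp_t} {A : gsimType d} {r : nat} {n : 'I_r -> nat}.
Context {phi : A -> gsim_prod (fun i : 'I_r => chain (n i))}.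
Hypothesis phi_iso : gsim_isomorphism phi.
Implicit Types x y : A.

Definition coord (i : 'I_r) x : chain (n i) := prod_coord (phi x) i.

Lemma coordI i x y : coord i (x `&` y) = coord i x `&` coord i y.
Proof. by rewrite /coord (gsim_morphI phi_iso.1) prod_ofE. Qed.

Lemma coord_imp i x y : coord i (imp x y) = imp (coord i x) (coord i y).
Proof. by rewrite /coord (gsim_morph_imp phi_iso.1) prod_ofE. Qed.

Lemma coord_sim i x : coord i (sim x) = sim (coord i x).
Proof. by rewrite /coord (gsim_morph_sim phi_iso.1) prod_ofE. Qed.

Lemma coord0 i : coord i \bot = \bot.
Proof. by rewrite /coord (gsim_morph0 phi_iso.1) prod_ofE. Qed.

Lemma coord1 i : coord i \top = \top.
Proof. by rewrite /coord (gsim_morph1 phi_iso.1) prod_ofE. Qed.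

Lemma coord_neg i x : coord i (neg x) = neg (coord i x).
Proof. by rewrite /neg coord_imp coord0. Qed.

Lemma coord_inj x y : (forall i, coord i x = coord i y) -> x = y.
Proof. by move=> eq_xy; apply/(bij_inj phi_iso.2)/gsim_prodP. Qed.

Lemma le_coord x y : (forall i, coord i x <= coord i y) -> x <= y.
Proof.
move=> le_xy; rewrite leEmeet; apply/eqP/coord_inj => i; rewrite coordI.
exact/meet_l/le_xy.
Qed.

Lemma coord_surj (f : forall i, chain (n i)) : exists x, forall i, coord i x = f i.
Proof.
have [psi _ psiK] := phi_iso.2.
by exists (psi (prod_of f)) => i; rewrite /coord psiK prod_ofE.
Qed.

End ChainProduct.

(** * The midpoint of a finite chain *)

Section ChainArithmetic.
Variable n : nat.
Implicit Types x y z : chain n.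

Lemma le_chainE x y : (x <= y) = ((x : 'I_n.-1.+1) <= (y : 'I_n.-1.+1))%N.
Proof. by []. Qed.

Lemma chain_top_neq_bot : (1 < n)%N -> (\top : chain n) != \bot.
Proof. by move=> n_gt1; rewrite -lex0 le_chainE /=; lia. Qed.

Lemma val_chain_sim x : ((sim x : 'I_n.-1.+1) = n.-1 - (x : 'I_n.-1.+1) :> nat)%N.
Proof. by rewrite /sim /= subSS. Qed.

(** The top has value [n.-1], so this is the middle for odd [n] and the lower of the two middle
    elements for positive even [n]. Since [n.-1./2 <= n.-1], [inord] never takes its default
    value. *)
Definition chain_mid : chain n := inord n.-1./2.

Lemma val_chain_mid : (chain_mid : 'I_n.-1.+1) = n.-1./2 :> nat.
Proof. by rewrite inordK //; lia. Qed.

Lemma chain_mid_le_sim : chain_mid <= sim chain_mid.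
Proof. by rewrite le_chainE val_chain_sim val_chain_mid; lia. Qed.

(** The values of [x] and [sim x] add up to [n.-1], so the smaller is at most half of it. *)
Lemma meet_sim_le_mid x : x `&` sim x <= chain_mid.
Proof.
rewrite leIx !le_chainE val_chain_sim val_chain_mid.
by have := ltn_ord x; lia.
Qed.

Lemma le_sim_le_mid x : x <= sim x -> x <= chain_mid.
Proof. by move=> /meet_l <-; apply: meet_sim_le_mid. Qed.

(** Rounding makes the values of [chain_mid] and its [sim] differ by at most one, so nothing fits
    strictly between. *)
Lemma chain_mid_covers :
  chain_mid != sim chain_mid -> covers (sim chain_mid) chain_mid.
Proof.
move=> neq_mid; split; first by rewrite lt_neqAle neq_mid chain_mid_le_sim.
move=> z []; rewrite !ltNge !le_chainE val_chain_sim val_chain_mid.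
by have := ltn_ord z; lia.
Qed.

Lemma covers_sim_mid x : covers (sim x) x -> x = chain_mid.
Proof.
move=> [lt_x no_z]; apply/le_anti/andP; split; first exact/le_sim_le_mid/ltW.
rewrite leNgt; apply/negP => lt_mid.
(* If [x] were smaller, then [x < chain_mid <= sim chain_mid < sim x], against covering. *)
apply: (no_z chain_mid); split=> //.
apply: le_lt_trans chain_mid_le_sim _.
by rewrite !ltNge !le_chainE !val_chain_sim !val_chain_mid in lt_mid *;
  have := ltn_ord x; lia.
Qed.

Lemma chain_negE x : neg x = if x == \bot then \top else \bot.
Proof. by rewrite /neg /imp /= /chain_imp lex0. Qed.

(** In a chain, [neg (sim z)] is [\top] for [z = \top] and [\bot] otherwise. The implication is
    [\top] at a fixed midpoint and returns [chain_mid] elsewhere. *)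
Lemma neg_sim_imp_mid :
  neg (sim (imp (sim chain_mid) chain_mid)) =
  if chain_mid == sim chain_mid then \top else \bot.
Proof.
have imp_mid : imp (sim chain_mid) chain_mid =
    if chain_mid == sim chain_mid then \top else chain_mid.
  by rewrite {1}/imp /= /chain_imp eq_le chain_mid_le_sim.
rewrite imp_mid chain_negE; case: (eqVneq chain_mid) => [_|neq_mid].
  by rewrite sim1 eqxx.
(* A midpoint that is not fixed is not [\top]: otherwise its [sim] would be [\bot], and
   [chain_mid <= sim chain_mid] would force equality. *)
case: eqVneq => // sim_mid0; case/eqP: neq_mid.
by apply/le_anti; rewrite chain_mid_le_sim sim_mid0 le0x.
Qed.

End ChainArithmetic.

(** * Condition (C) and the two characterizations *)

Section CMGTheory.
Context {d : Order.disp_t} {A : mgsimType d}.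

Lemma CMG_mexists_le (c : A) : CMG A -> c <= sim c -> mexists c <= sim (mexists c).
Proof.
move=> cmg le_c; have := cmg c.
by rewrite meet_l // join_r // sim_mexists.
Qed.

(** The pair [c <= sim c] separates the two sides of (C): the left one is below [mexists c = c], and
    dually the right one is above [sim c]. *)
Lemma mexists_fix_CMG (c : A) : c <= sim c -> mexists c = c ->
  (forall x : A, x `&` sim x <= c) -> CMG A.
Proof.
move=> le_c ec max_c x; apply: le_trans (mexists_homo (max_c x)) _.
rewrite ec; apply: (le_trans le_c).
rewrite -[sim c](mexists_fix_mforall (mexists_fix_sim ec)) mforall_homo //.
by rewrite -[x `|` _]simK le_sim simU max_c.
Qed.

End CMGTheory.

Theorem theorem4p5 (d : Order.disp_t) (A : finMGsimType d)
    (r : nat) (n : 'I_r -> nat) (n_gt1 : forall i : 'I_r, (1 < n i)%N)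
    (phi : A -> gsim_prod (fun i : 'I_r => chain (n i)))
    (phi_iso : gsim_isomorphism phi)
    (A_si : subdirectly_irreducible A) :
  (forall c : A, c = sim c -> (CMG A <-> in_mexists c)) /\
  (~ (exists c : A, c = sim c) ->
   (CMG A <->
    exists t : A, in_mexists t /\
      forall i : 'I_r, covers (prod_coord (phi (sim t)) i) (prod_coord (phi t) i))).
Proof.
have [c coord_c] := coord_surj phi_iso (fun i => chain_mid (n i)).
have le_c : c <= sim c.
  apply: (le_coord phi_iso) => i.
  by rewrite (coord_sim phi_iso) coord_c chain_mid_le_sim.
have le_sim_le_c x : x <= sim x -> x <= c.
  move=> le_x; apply: (le_coord phi_iso) => i; rewrite coord_c.
  apply: le_sim_le_mid.
  by rewrite leEmeet -(coord_sim phi_iso) -(coordI phi_iso) meet_l.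
have max_c x : x `&` sim x <= c.
  by apply: le_sim_le_c; rewrite simI simK joinC leIxl ?leUl.
have cmgP : CMG A <-> mexists c = c.
  split=> [cmg|ec]; last exact: mexists_fix_CMG max_c.
  (* By (C), [mexists c] is below its own [sim], and [c] is the greatest such element. *)
  apply/le_anti; rewrite mexists_gex andbT le_sim_le_c //.
  exact: CMG_mexists_le.
split=> [e fix_e|no_fix].
  suff -> : e = c by apply: iff_trans cmgP (iff_sym (in_mexistsP c)).
  have le_ec : e <= c by apply: le_sim_le_c; rewrite -fix_e.
  (* Applying [sim] to [e <= sim c] gives [c <= sim e = e]. *)
  apply/le_anti; rewrite le_ec /=.
  by rewrite fix_e -le_sim simK (le_trans le_ec le_c).
split=> [/cmgP ec|[t [et cov_t]]]; last first.
  (* The covering condition pins down every coordinate of [t] as a midpoint. *)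
  suff eq_ct : c = t by apply/cmgP/in_mexistsP; rewrite eq_ct.
  apply: (coord_inj phi_iso) => i; rewrite coord_c; apply/esym/covers_sim_mid.
  by have := cov_t i; rewrite -!/(coord _ _) (coord_sim phi_iso).
exists c; split=> [|i]; first exact/in_mexistsP.
pose b := neg (sim (imp (sim c) c)).
have coord_b j : coord (phi := phi) j b =
    if chain_mid (n j) == sim (chain_mid (n j)) then \top else \bot.
  rewrite (coord_neg phi_iso) (coord_sim phi_iso) (coord_imp phi_iso).
  by rewrite (coord_sim phi_iso) coord_c neg_sim_imp_mid.
have cb : central b.
  split.
    (* [neg] is an implication into [\bot], so [b] is a term in [c] and stays in the range. *)
    have esc := mexists_fix_sim ec.
    apply: mexists_fix_imp; last exact: mexists0.
    exact/mexists_fix_sim/mexists_fix_imp.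
  (* Every coordinate of [b] is [\bot] or [\top], hence complemented by [sim]. *)
  apply: (coord_inj phi_iso) => j.
  rewrite (coordI phi_iso) (coord_sim phi_iso) (coord0 phi_iso) coord_b.
  by case: ifP => _; rewrite ?meet0x // meet1x sim1.
rewrite -!/(coord _ _) (coord_sim phi_iso) coord_c.
apply: chain_mid_covers; apply/negP => mid_i.
(* A fixed midpoint in chain [i] makes that coordinate of [b] equal to [\top], which excludes
   [b = \bot]. If [b = \top], all midpoints are fixed and [c] is a forbidden fixed point. *)
have [b0|b1] := subdirectly_irreducible_central A_si cb.
  by have := coord_b i; rewrite b0 (coord0 phi_iso) mid_i => /esym/eqP;
    rewrite (negPf (chain_top_neq_bot (n_gt1 i))).
apply: no_fix; exists c; apply: (coord_inj phi_iso) => j.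
rewrite (coord_sim phi_iso) coord_c; apply/eqP.
have := coord_b j; rewrite b1 (coord1 phi_iso); case: ifP => // _ /eqP.
by rewrite (negPf (chain_top_neq_bot (n_gt1 j))).
Qed.
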